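(* Let $m$ and $d$ be positive integers. Suppose $a_1\leq\cdots\leq a_t$ and $b_1,\dots,b_s$ are sequences of nonnegative integers such that $$b_1\leq b_2=\cdots=b_s=\binom{m-1+d}{d}$$ and $b_s\geq a_i$ for all $i\leq t$. If $a_1+\cdots+a_t\leq b_1+\cdots+b_s$, then $$a_1^{\langle d\rangle}+\cdots+a_t^{\langle d\rangle}\leq b_1^{\langle d\rangle}+\cdots+b_s^{\langle d\rangle}.$$
   Context: For nonnegative integers $p,q$, set $\binom{p}{q}=\frac{p!}{(p-q)!\,q!}$ if $p\geq q$ and $\binom{p}{q}=0$ if $p<q$. For all positive integers $a$ and $d$, there exist unique integers $k_d>k_{d-1}>\cdots>k_j\geq j\geq 1$ such that $$a=\binom{k_d}{d}+\binom{k_{d-1}}{d-1}+\cdots+\binom{k_j}{j}$$ (here $k_d$ is the largest integer with $a\geq\binom{k_d}{d}$); the sequence $k_d,\dots,k_j$ is called the (Macaulay) $d$-binomial representation of $a$. For each positive integer $d$, Macaulay's function $*^{\langle d\rangle}:\mathbb N\to\mathbb N$ (where $\mathbb N$ includes $0$) is defined by $$a^{\langle d\rangle}=\binom{k_d+1}{d+1}+\binom{k_{d-1}+1}{d}+\cdots+\binom{k_j+1}{j+1}$$ for $a>0$ with $d$-binomial representation $k_d,\dots,k_j$, and $0^{\langle d\rangle}=0$. The lengths $t,s$ of the sequences are positive integers. *)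

(* Defs.v *)
From mathcomp Require Import all_boot.
From mathcomp Require Import zify.

Set Implicit Arguments.
Unset Strict Implicit.
Unset Printing Implicit Defensive.

(* [binomial_rep d a ks] : the sequence ks = [:: k_d; k_(d-1); ...; k_j] is a
   d-binomial representation of a.  Its length is d - j + 1, so j >= 1 reads
   size ks <= d, and k_j >= j reads d - size ks < last 0 ks; the term of
   position i in ks is k_(d-i). *)
Definition binomial_rep (d a : nat) (ks : seq nat) : Prop :=
  [/\ 0 < size ks <= d,
      sorted gtn ks,
      d - size ks < last 0 ks
    & a = \sum_(i < size ks) 'C(nth 0 ks i, d - i)].

(* The largest k with 'C(k, d) <= a; for d > 0 such a k is less than a + d. *)
Definition macaulay_top (d a : nat) : nat :=
  \max_(k < a + d | 'C(k, d) <= a) k.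

(* The representation, computed greedily until the remainder is 0; see
   [macaulay_repP].  It is empty for a = 0. *)
Fixpoint macaulay_rep (d a : nat) : seq nat :=
  if d is d'.+1 then
    if a is 0 then [::]
    else let k := macaulay_top d a in k :: macaulay_rep d' (a - 'C(k, d))
  else [::].

(* Macaulay's function a^<d>, for d > 0; the sum is empty when a = 0. *)
Definition macaulay (d a : nat) : nat :=
  let ks := macaulay_rep d a in
  \sum_(i < size ks) 'C((nth 0 ks i).+1, (d - i).+1).

Lemma ltn_bin_addn d a : 0 < d -> a < 'C(a + d, d).
Proof.
case: d => // d _; elim: a => [|a IHa]; first by rewrite add0n binn.
rewrite addSn binS; have : 0 < 'C(a + d.+1, d) by rewrite bin_gt0; lia.
lia.
Qed.

Lemma macaulay_topP d a : 0 < d ->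
  'C(macaulay_top d a, d) <= a < 'C((macaulay_top d a).+1, d).
Proof.
move=> d_gt0; rewrite /macaulay_top.
have ad_gt0 : 0 < a + d by lia.
have P0 : 'C(Ordinal ad_gt0, d) <= a by rewrite /= bin_small.
rewrite (bigmax_eq_arg (Ordinal ad_gt0)) //.
case: arg_maxnP => // i Pi maxi; rewrite Pi /= ltnNge; apply/negP => Pi1.
have [lt_i1|ge_i1] := ltnP i.+1 (a + d).
  by have := maxi (Ordinal lt_i1) Pi1; rewrite /= ltnn.
have := leq_trans (leq_bin2l d ge_i1) Pi1.
by rewrite leqNgt ltn_bin_addn.
Qed.

Lemma macaulay_top_uniq d a k :
  0 < d -> 'C(k, d) <= a < 'C(k.+1, d) -> macaulay_top d a = k.
Proof.
move=> d_gt0 /andP[lek ltk]; have /andP[let_ ltt] := macaulay_topP a d_gt0.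
apply/eqP; rewrite eqn_leq; apply/andP; split; rewrite leqNgt; apply/negP => h.
  by have := leq_trans (leq_ltn_trans let_ ltk) (leq_bin2l d h); rewrite ltnn.
by have := leq_trans (leq_ltn_trans lek ltt) (leq_bin2l d h); rewrite ltnn.
Qed.

Lemma macaulay_top_ge d a : 0 < d -> 0 < a -> d <= macaulay_top d a.
Proof.
move=> d_gt0 a_gt0; rewrite leqNgt; apply/negP => lt_d.
have /andP[_] := macaulay_topP a d_gt0; rewrite ltnNge => /negP; apply.
by apply: leq_trans a_gt0; rewrite (leq_trans (leq_bin2l d lt_d)) ?binn.
Qed.

Lemma binomial_rep_lt d a k ks :
  binomial_rep d a (k :: ks) -> a < 'C(k.+1, d).
Proof.
elim: ks d a k => [|k' ks IHks] [|d] a k [] //=.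
  move=> _ _ lt_k ->; rewrite big_ord1 /= binS.
  by rewrite -[X in X < _]addn0 ltn_add2l bin_gt0; lia.
move=> sz /andP[ltk' srt] lt_last ->.
rewrite big_ord_recl /= binS ltn_add2l.
have rep : binomial_rep d (\sum_(i < size (k' :: ks)) 'C(nth 0 (k' :: ks) i, d - i))
             (k' :: ks) by split.
exact: leq_trans (IHks _ _ _ rep) (leq_bin2l d ltk').
Qed.

Lemma binomial_rep_gt0 d a ks : binomial_rep d a ks -> 0 < a.
Proof.
elim: ks d a => [|k ks IHks] [|d] a [] //=.
case: ks IHks => [|k' ks] IHks /=.
  by move=> _ _ lt_k ->; rewrite big_ord1 bin_gt0 /=; lia.
move=> sz /andP[ltk' srt] lt_last ->; rewrite big_ord_recl /= addn_gt0 orbC.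
by rewrite (IHks d) //; split.
Qed.

Lemma macaulay_rep_head d a : 0 < d -> 0 < a ->
  macaulay_rep d a = macaulay_top d a :: behead (macaulay_rep d a).
Proof. by case: d a => [|d] []. Qed.

Lemma macaulay_rep_correct d a :
  0 < d -> 0 < a -> binomial_rep d a (macaulay_rep d a).
Proof.
elim: d a => // d IHd [//|a] _ _.
set A := a.+1; rewrite /macaulay_rep -/macaulay_rep /A -/A.
have /andP[] := @macaulay_topP d.+1 A isT; set k := macaulay_top _ _ => lek ltk.
have gek : d < k by apply: macaulay_top_ge.
have [r0|r_gt0] := posnP (A - 'C(k, d.+1)).
  have -> : macaulay_rep d (A - 'C(k, d.+1)) = [::] by rewrite r0; case: (d).
  by split=> //=; [lia | rewrite big_ord1 /= subn0; lia].
have lt_r : A - 'C(k, d.+1) < 'C(k, d) by move: ltk; rewrite binS; lia.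
have d_gt0 : 0 < d by case: (d) lt_r r_gt0 => //; rewrite bin0; lia.
have := IHd _ d_gt0 r_gt0.
have := macaulay_rep_head d_gt0 r_gt0.
set r := A - _ in r_gt0 lt_r *.
move: (macaulay_rep d r) => [//|k' ks] [->] [] /= sz srt lt_last Er.
have ltk' : macaulay_top d r < k.
  rewrite ltnNge; apply/negP => h.
  have /andP[le_r _] := macaulay_topP r d_gt0.
  by have := leq_trans (leq_bin2l d h) le_r; lia.
split=> //=; first by rewrite ltk'.
by rewrite big_ord_recl /= subn0 -[X in _ + X]Er subnKC.
Qed.

Lemma macaulay_repP d a ks :
  0 < d -> 0 < a -> binomial_rep d a ks <-> ks = macaulay_rep d a.
Proof.
move=> d_gt0 a_gt0; split; last by move->; apply: macaulay_rep_correct.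
elim: ks d a {d_gt0 a_gt0} => [|k ks IHks] d a rep; first by case: rep.
have a_gt0 := binomial_rep_gt0 rep; have lt_a := binomial_rep_lt rep.
case: d a rep a_gt0 lt_a => [|d] [|a] // [] // sz srt lt_last Ea _ lt_a.
have le_a : 'C(k, d.+1) <= a.+1 by rewrite Ea big_ord_recl leq_addr.
rewrite /macaulay_rep -/macaulay_rep /= (@macaulay_top_uniq _ _ k) ?le_a //.
congr (_ :: _); move: Ea; rewrite /= big_ord_recl /= => ->; rewrite addKn.
case: ks IHks sz srt lt_last => [|k' ks] IHks sz srt lt_last.
  by rewrite big_ord0; case: (d).
by apply: IHks; move: srt => /= /andP[_ srt]; split.
Qed.

(* Main.v *)
Require Import Defs.
From mathcomp Require Import all_boot.
From mathcomp Require Import zify.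

Set Implicit Arguments.
Unset Strict Implicit.
Unset Printing Implicit Defensive.

(** Put M = 'C(m - 1 + d, d), the number of monomials of degree d in m
    variables.  The theorem reduces to two inequalities for f = macaulay d on
    [0, M]:
      - f i + f j <= f (i + j)              when i + j <= M,
      - f i + f j <= f M + f (i + j - M)    when i + j >= M.
    Indeed they allow the a_i to be merged one after the other
    ([sum_merge_le]) into q copies of M and one remainder c < M with the same
    total, without decreasing the sum of the values of f; since
    q * M + c <= b_1 + (s - 1) * M, comparing with the b_j is then immediate.

    Both inequalities are about the increments of f.  By [macaulay_psum], f l
    is the sum of the first l letters of a finite word, [growth_word (m - 1) d],
    of length M, which obeys the Pascal-like recursion
      growth_word n.+1 d.+1 = growth_word n d.+1 ++ growth_word n.+1 d.
    The two inequalities say that the word is [balanced]: among its windows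
    (blocks of consecutive letters) of a given length, the initial one has the
    least sum and the final one the greatest.

    Balance is proved by induction along the recursion.  A concatenation u ++ v
    of balanced words is balanced as soon as v dominates u, that is, as soon as
    each prefix and each suffix of v has at least the sum of the prefix or
    suffix of u of the same length ([balanced_cat]).  Domination, in turn,
    follows from balance of the shorter words ([dominated_growth_word]):
    raising n or lowering d can only increase the prefix and suffix sums. *)

(** * Windows in words of natural numbers *)

Definition psum (w : seq nat) (l : nat) : nat := sumn (take l w).

Lemma psum0 w : psum w 0 = 0.
Proof. by rewrite /psum take0. Qed.

Lemma psum_size w : psum w (size w) = sumn w.
Proof. by rewrite /psum take_size. Qed.

Lemma psum_catl u v l : l <= size u -> psum (u ++ v) l = psum u l.
Proof. by move=> le_l; rewrite /psum takel_cat. Qed.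

Lemma psum_catr u v l : psum (u ++ v) (size u + l) = psum u (size u) + psum v l.
Proof.
by rewrite /psum take_cat ltnNge leq_addr addKn take_size sumn_cat.
Qed.

(** In terms of windows: the first clause, read as
    psum w i <= psum w (i + j) - psum w j, bounds the initial window of length
    i by the window of length i starting at j.  The second, read as
    psum w i - psum w (i + j - size w) <= psum w (size w) - psum w j, bounds a
    window of length size w - j by the final window of that length. *)
Definition balanced (w : seq nat) : Prop :=
  (forall i j, i + j <= size w -> psum w i + psum w j <= psum w (i + j)) /\
  (forall i j, i <= size w -> j <= size w -> size w <= i + j ->
     psum w i + psum w j <= psum w (size w) + psum w (i + j - size w)).

(** The subtraction-free form of: for each possible common length l, the
    prefixes, and also the suffixes, of length l of u and v satisfy
    sum in u <= sum in v. *)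
Definition dominated (u v : seq nat) : Prop :=
  forall l, l <= size u -> l <= size v ->
    psum u l <= psum v l /\
    psum u (size u) + psum v (size v - l)
      <= psum v (size v) + psum u (size u - l).

Lemma balanced_seq1 c : balanced [:: c].
Proof.
split=> [[|[|i]] [|[|j]]|[|[|i]] [|[|j]]] //=; rewrite /psum /=; lia.
Qed.

Lemma psum_cat_gt u v l : size u <= l ->
  psum (u ++ v) l = psum u (size u) + psum v (l - size u).
Proof. by move=> le_u; rewrite -psum_catr subnKC. Qed.

(** A window of u ++ v inside u or inside v is compared within that word, and
    domination moves the comparison from one word to the other.  A window across
    the boundary is a suffix of u followed by a prefix of v.  When the initial
    window of the same length fits in u, balance of u bounds its part of the
    length of that suffix, and domination the rest; otherwise u cancels its part
    of the straddling window, which leaves prefixes and suffixes to compare.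
    The final window is treated symmetrically. *)
Lemma balanced_cat u v :
  balanced u -> balanced v -> dominated u v -> balanced (u ++ v).
Proof.
move=> [minu maxu] [minv maxv] dom; rewrite /balanced size_cat.
split.
- move=> i j; wlog le_ij : i j / j <= i => [hw h|le_s].
    have [le_ji|/ltnW le_ij] := leqP j i; first exact: hw.
    by have := hw j i le_ij; rewrite [j + i]addnC; lia.
  have [le_iju|/ltnW ge_iju] := leqP (i + j) (size u).
    by rewrite !psum_catl; [apply: minu|lia..].
  rewrite (psum_cat_gt _ ge_iju).
  have [le_i|/ltnW ge_i] := leqP i (size u); last first.
    rewrite (psum_cat_gt _ ge_i).
    have [le_j|/ltnW ge_j] := leqP j (size u).
      rewrite psum_catl //.
      have [] := dom j le_j _; first lia.
      have := minv (i - size u) j; have -> : i - size u + j = i + j - size u by lia.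
      lia.
    rewrite (psum_cat_gt _ ge_j).
    (* The extra copy of u on the left is paid for by the prefix of v of the
       length of u, which fits in v because i and j are both at least size u. *)
    have [] := dom (size u) (leqnn _) _; first lia.
    have := minv (i - size u + (j - size u)) (size u).
    have := minv (i - size u) (j - size u).
    have -> : i - size u + (j - size u) + size u = i + j - size u by lia.
    lia.
  rewrite !psum_catl; [|lia..].
  have := maxu i j le_i _ ge_iju; have [] := dom (i + j - size u); lia.
- move=> i j; wlog le_ij : i j / j <= i => [hw h1 h2 h3|le_i le_j ge_ij].
    have [le_ji|/ltnW le_ij] := leqP j i; first exact: hw.
    by have := hw j i le_ij; rewrite [j + i]addnC; lia.
  have [le_iu|/ltnW ge_i] := leqP i (size u).
    rewrite [psum _ (size u + _)]psum_cat_gt ?leq_addr // addKn.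
    rewrite !psum_catl; [|lia..].
    (* The whole of v is exchanged for a suffix of u of the same length, which
       takes two uses of balance of u. *)
    have := maxu i j le_iu _ _; have := maxu (i + j - size u) (size u - size v).
    have -> : i + j - size u + (size u - size v) - size u
            = i + j - (size u + size v) by lia.
    by have [] := dom (size v); rewrite ?subnn ?psum0; lia.
  rewrite [psum _ (size u + _)]psum_cat_gt ?leq_addr // addKn.
  rewrite (psum_cat_gt _ ge_i).
  have [le_ju|/ltnW ge_j] := leqP j (size u).
    rewrite !psum_catl; [|lia..].
    (* Domination is applied to the suffixes of length |u ++ v| - i, the part of
       v beyond i. *)
    have := maxu j (i + j - (size u + size v) + (size u - j)).
    have -> : j + (i + j - (size u + size v) + (size u - j)) - size u
            = i + j - (size u + size v) by lia.
    have [] := dom (size u + size v - i); [lia..|].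
    have -> : size v - (size u + size v - i) = i - size u by lia.
    have -> : size u - (size u + size v - i)
            = i + j - (size u + size v) + (size u - j) by lia.
    lia.
  rewrite (psum_cat_gt _ ge_j).
  have [le_k|/ltnW ge_k] := leqP (i + j - (size u + size v)) (size u); last first.
    rewrite (psum_cat_gt _ ge_k).
    have := maxv (i - size u) (j - size u).
    have -> : i - size u + (j - size u) - size v
            = i + j - (size u + size v) - size u by lia.
    lia.
  rewrite psum_catl //.
  have := minv (i - size u) (j - size u).
  have [] := dom (size u - (i + j - (size u + size v))); [lia..|].
  rewrite subKn //.
  have -> : size v - (size u - (i + j - (size u + size v)))
          = i - size u + (j - size u) by lia.
  lia.
Qed.

(** The suffix v is a window of z ++ v, and so are its prefixes. *)
Lemma psum_le_of_suffix z v l :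
  balanced (z ++ v) -> l <= size v -> psum (z ++ v) l <= psum v l.
Proof.
move=> [minw _] le_l; have := minw (size z) l.
by rewrite psum_catr psum_catl // size_cat; lia.
Qed.

Lemma psum_le_of_prefix u z l : balanced (u ++ z) -> l <= size u ->
  psum u (size u) + psum (u ++ z) (size (u ++ z) - l)
    <= psum (u ++ z) (size (u ++ z)) + psum u (size u - l).
Proof.
move=> [_ maxw] le_l; have := maxw (size u) (size (u ++ z) - l).
have -> : size u + (size (u ++ z) - l) - size (u ++ z) = size u - l.
  by rewrite size_cat; lia.
by rewrite (psum_catl z (leqnn _)) (psum_catl z (leq_subr l _)) size_cat; lia.
Qed.

(** * Growth words *)

(** List the monomials of degree d in x_1, ..., x_(n+1), those free of x_(n+1)
    first and then those divisible by it, each group ordered recursively.  The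
    letter at a monomial w is the least index i with x_i dividing w (n + 1 if
    w = 1), which is the number of monomials v = x_j * w such that x_j is the
    variable of least index in v.  Each v of degree d + 1 comes from exactly one
    w, so the prefix sums count the growth of initial segments. *)
Fixpoint growth_word (n : nat) : nat -> seq nat :=
  if n is n'.+1 then
    fix growth_word_n (d : nat) : seq nat :=
      if d is d'.+1 then growth_word n' d ++ growth_word_n d' else [:: n.+1]
  else fun=> [:: 1].

Lemma growth_wordn0 n : growth_word n 0 = [:: n.+1].
Proof. by case: n. Qed.

Lemma growth_wordSS n d :
  growth_word n.+1 d.+1 = growth_word n d.+1 ++ growth_word n.+1 d.
Proof. by []. Qed.

Lemma size_growth_word n d : size (growth_word n d) = 'C(n + d, d).
Proof.
elim: n d => [|n IHn] d; first by rewrite binn.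
elim: d => [|d IHd]; first by rewrite bin0.
by rewrite growth_wordSS size_cat IHn IHd [n.+1 + d.+1]addSn binS addSnnS.
Qed.

Lemma size_growth_word_gt0 n d : 0 < size (growth_word n d).
Proof. by rewrite size_growth_word bin_gt0 leq_addl. Qed.

Lemma sumn_growth_word n d : sumn (growth_word n d) = 'C((n + d).+1, d.+1).
Proof.
elim: n d => [|n IHn] d; first by rewrite binn.
elim: d => [|d IHd]; first by rewrite addn0 bin1 /= addn0.
by rewrite growth_wordSS sumn_cat IHn IHd [n.+1 + d.+1]addSn binS addSnnS.
Qed.

Lemma growth_word_suffix n d e :
  exists z, growth_word n (d + e) = z ++ growth_word n d.
Proof.
case: n => [|n]; first by exists [::].
elim: e => [|e [z IHe]]; first by exists [::]; rewrite addn0.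
by exists (growth_word n (d + e).+1 ++ z); rewrite addnS growth_wordSS IHe catA.
Qed.

Lemma growth_word_prefix n e d :
  exists z, growth_word (n + e) d.+1 = growth_word n d.+1 ++ z.
Proof.
elim: e => [|e [z IHe]]; first by exists [::]; rewrite addn0 cats0.
by exists (z ++ growth_word (n + e).+1 d); rewrite addnS growth_wordSS IHe catA.
Qed.

Lemma psum1_growth_word n d : 0 < psum (growth_word n d) 1 <= n.+1.
Proof.
elim: n d => [|n IHn] d //.
case: d => [|d]; first by rewrite /psum /= addn0 ltnS leqnn.
rewrite growth_wordSS psum_catl ?size_growth_word_gt0 //.
by have := IHn d.+1; lia.
Qed.

(** Prefixes and suffixes are handled together because each case needs the other
    on shorter words.  Write u for the dominated and v for the dominating word.
    For prefixes with n' < n, split v = x ++ y.  A prefix of v that goes beyond x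
    is x followed by a prefix of y; the prefix of u of the same length is cut the
    other way round, into a short prefix, dominated by that of y, and a window of
    length size x, at most the suffix of u of this length, hence at most x.  For
    suffixes with d < d', split u = z ++ x.  A suffix of u that goes beyond x is a
    suffix of z followed by x; the suffix of v of the same length is cut into a
    window of length size x, at least the prefix of v and hence at least x, and a
    short suffix, which dominates that of z.  When n' = n or d = d' > 0, one word
    is a suffix or prefix of the other and balance suffices. *)
Lemma dominated_growth_word N :
    (forall n d, n + d <= N -> balanced (growth_word n d)) ->
  forall n d n' d', n + d <= N -> n' + d' <= N -> n' <= n -> d <= d' ->
    dominated (growth_word n' d') (growth_word n d).
Proof.
move=> bal n d n' d'; have [K] := ubnP (n + d + (n' + d')).
elim: K => // K IHK in n d n' d' * => ltK le_nd le_nd' le_n le_d l.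
have [minv maxv] := bal _ _ le_nd; have [minu maxu] := bal _ _ le_nd'.
have /andP[hv_gt0 hv_le] := psum1_growth_word n d.
have /andP[hu_gt0 hu_le] := psum1_growth_word n' d'.
case: l => [|l le_lu le_lv]; first by rewrite !psum0 !subn0 addnC.
split.
- have [En|ne_n] := eqVneq n' n.
    have [z Ez] := growth_word_suffix n d (d' - d).
    rewrite subnKC // -En in Ez; rewrite Ez -En.
    by apply: psum_le_of_suffix; rewrite -?Ez ?En //; apply: bal; rewrite -En.
  case: n d => [|n] [|d]
    in le_nd le_n le_d le_lv ltK ne_n minv maxv hv_gt0 hv_le *; try lia.
    move: le_lv; rewrite growth_wordn0 /= => le_l1.
    have -> : l = 0 by lia.
    by rewrite {2}/psum /=; lia.
  rewrite growth_wordSS in le_lv *.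
  have [le_l|/ltnW ge_l] := leqP l.+1 (size (growth_word n d.+1)).
    rewrite psum_catl //.
    have dom_x : dominated (growth_word n' d') (growth_word n d.+1).
      by apply: IHK; lia.
    by have [] := dom_x l.+1 le_lu le_l.
  rewrite psum_cat_gt //; rewrite size_cat in le_lv.
  set x := growth_word n d.+1 in le_lv ge_l *.
  set y := growth_word n.+1 d in le_lv *.
  set u := growth_word n' d' in minu maxu le_lu *.
  have dom_x : dominated u x by apply: IHK; lia.
  have dom_y : dominated u y by apply: IHK; lia.
  have [||_] := dom_x (size x); [lia|exact: leqnn|].
  have [||] := dom_y (l.+1 - size x); [lia..|].
  rewrite subnn psum0.
  have := maxu l.+1 (size u - size x).
  have -> : l.+1 + (size u - size x) - size u = l.+1 - size x by lia.
  lia.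
- have [Ed|ne_d] := eqVneq d d'.
    have [d0|d_gt0] := posnP d'.
      move: le_lu; rewrite Ed d0 !growth_wordn0 /psum /=.
      by case: l {le_lv} => //= _; lia.
    have [z Ez] := growth_word_prefix n' (n - n') d'.-1.
    rewrite subnKC // prednK // in Ez; rewrite Ed Ez.
    by apply: psum_le_of_prefix => //; rewrite -Ez -Ed; exact: bal.
  case: n' d' => [|n'] [|d']
    in le_nd' le_n le_d le_lu ltK ne_d minu maxu hu_gt0 hu_le *; try lia.
    (* Here u is the one-letter word 1, and the last letter of v is at least its
       first one, which is positive. *)
    have -> : l = 0 by move: le_lu; rewrite /=; lia.
    rewrite {1 4}/psum /=.
    by have := minv (size (growth_word n d) - 1) 1; rewrite subnK; lia.
  rewrite growth_wordSS in le_lu *.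
  set z := growth_word n' d'.+1 in le_lu *; set x := growth_word n'.+1 d' in le_lu *.
  set v := growth_word n d in minv maxv le_lv *.
  rewrite size_cat psum_catr in le_lu *.
  have [le_l|/ltnW ge_l] := leqP l.+1 (size x).
    rewrite -addnBA // psum_catr.
    have dom_x : dominated x v by apply: IHK; lia.
    by have [] := dom_x l.+1 le_l le_lv; lia.
  rewrite psum_catl; last lia.
  have dom_x : dominated x v by apply: IHK; lia.
  have dom_z : dominated z v by apply: IHK; lia.
  have [||+ _] := dom_x (size x); [exact: leqnn|lia|].
  have [||_] := dom_z (l.+1 - size x); [lia..|].
  have -> : size z - (l.+1 - size x) = size z + size x - l.+1 by lia.
  have := minv (size x) (size v - l.+1).
  have -> : size x + (size v - l.+1) = size v - (l.+1 - size x) by lia.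
  lia.
Qed.

(** The two halves of a growth word and all pairs met in the proof that the second
    dominates the first have index sum below n + d, whence a strong induction on
    n + d. *)
Lemma balanced_growth_word n d : balanced (growth_word n d).
Proof.
have [N] := ubnP (n + d); elim: N => // N IHN in n d *.
case: n d => [|n] [|d] ltN; try exact: balanced_seq1.
rewrite growth_wordSS; apply: balanced_cat; [apply: IHN; lia..|].
apply: (@dominated_growth_word (n + d).+1) => [n1 d1 le1||||]; [|lia..].
by apply: IHN; lia.
Qed.

(** * Macaulay's function as a prefix sum *)

Lemma macaulay0 d : macaulay d 0 = 0.
Proof. by rewrite /macaulay; case: d => [|d]; rewrite /= big_ord0. Qed.

(** The bound r < 'C(k, d) makes k the greedy choice; the rest of the greedy
    representation is then that of r. *)
Lemma macaulay_step k d r : r < 'C(k, d) ->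
  macaulay d.+1 ('C(k, d.+1) + r) = 'C(k.+1, d.+2) + macaulay d r.
Proof.
move=> lt_r; have top : macaulay_top d.+1 ('C(k, d.+1) + r) = k.
  by apply: macaulay_top_uniq => //; rewrite leq_addr binS ltn_add2l.
have le_dk : d <= k by rewrite -bin_gt0; lia.
have [a0|a_gt0] := posnP ('C(k, d.+1) + r).
  have r0 : r = 0 by lia.
  have lt_kd : k < d.+1 by rewrite ltnNge -bin_gt0; lia.
  by rewrite a0 r0 !macaulay0 bin_small.
rewrite /macaulay; have -> : macaulay_rep d.+1 ('C(k, d.+1) + r)
    = k :: macaulay_rep d r.
  by case E: ('C(k, d.+1) + r) a_gt0 => [|a] // _; rewrite /= -E top addKn.
by rewrite /= big_ord_recl /= subn0; congr (_ + _).
Qed.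

Lemma macaulay_bin k d : d <= k -> macaulay d.+1 'C(k, d.+1) = 'C(k.+1, d.+2).
Proof.
move=> le_dk; have := @macaulay_step k d 0; rewrite addn0 macaulay0 addn0.
by apply; rewrite bin_gt0.
Qed.

(** Both sides obey the same recursion at the cut l = 'C((n + d).+1, d.+1), the
    length of the first half of the word.  The end point l = 'C((n + d).+2, d.+1),
    where the greedy representation jumps to a single term, is the one value that
    [macaulay_step] does not reach. *)
Lemma macaulay_psum n d l : 0 < d -> l <= 'C(n + d, d) ->
  macaulay d l = psum (growth_word n d) l.
Proof.
elim: d n l => // d IHd n l _; elim: n l => [|n IHn] l.
  rewrite binn; case: l => [|[|l]] // _; first by rewrite macaulay0.
  by have := macaulay_bin (leqnSn d); rewrite !binn.
rewrite growth_wordSS => le_l.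
have [le_lU|/ltnW ge_l] := leqP l (size (growth_word n d.+1)).
  by rewrite psum_catl // IHn // -size_growth_word.
rewrite psum_cat_gt // psum_size sumn_growth_word.
move: le_l ge_l; rewrite size_growth_word addSn binS addnS => le_l ge_l.
set r := l - _; have El : l = 'C((n + d).+1, d.+1) + r by rewrite subnKC.
have le_r : r <= 'C((n + d).+1, d) by rewrite -(leq_add2l 'C((n + d).+1, d.+1)) -El.
rewrite El; move: le_r; rewrite leq_eqVlt => /predU1P[->|lt_r].
  rewrite -binS macaulay_bin; last lia.
  rewrite -[(n + d).+1]/(n.+1 + d) -size_growth_word psum_size sumn_growth_word.
  by rewrite binS.
rewrite macaulay_step //; congr (_ + _).
have [d0|d_gt0] := posnP d; last by apply: IHd => //; rewrite addSn ltnW.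
have -> : r = 0 by move: lt_r; rewrite d0 bin0; lia.
by rewrite macaulay0 psum0.
Qed.

(** * Merging the summands *)

(** Adding a new summand x to the remainder c either keeps c + x < M, by
    superadditivity, or completes one more copy of M, by the exchange
    inequality. *)
Lemma sum_merge_le (f : nat -> nat) (M t : nat) (a : nat -> nat) :
    0 < M -> f 0 = 0 ->
    (forall i j, i + j <= M -> f i + f j <= f (i + j)) ->
    (forall i j, i <= M -> j <= M -> M <= i + j ->
       f i + f j <= f M + f (i + j - M)) ->
    (forall i, 1 <= i -> i <= t -> a i <= M) ->
  let A := \sum_(1 <= i < t.+1) a i in
  \sum_(1 <= i < t.+1) f (a i) <= (A %/ M) * f M + f (A %% M).
Proof.
move=> M_gt0 f0 f_add f_exch; elim: t => [|t IHt] le_a /=.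
  by rewrite !big_geq.
rewrite !(big_nat_recr t.+1) //=; set A := \sum_(1 <= i < t.+1) a i.
have {}IHt := IHt (fun i i_gt0 le_i => le_a i i_gt0 (leqW le_i)).
apply: leq_trans (leq_add IHt (leqnn _)) _; rewrite -/A.
have le_at : a t.+1 <= M by apply: le_a.
have lt_c : A %% M < M by rewrite ltn_mod.
rewrite [in X in _ <= X](divn_eq A M) -[_ + _ + a _]addnA.
rewrite divnMDl // modnMDl.
have [lt_s|ge_s] := ltnP (A %% M + a t.+1) M.
  rewrite (divn_small lt_s) (modn_small lt_s) addn0 -addnA leq_add2l.
  exact: f_add (ltnW lt_s).
rewrite -(subnK ge_s); set k := _ - M.
have lt_k : k < M by rewrite /k; lia.
rewrite divnDr ?dvdnn // modnDr divnn M_gt0 (divn_small lt_k) (modn_small lt_k).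
rewrite add0n mulnDl mul1n -!addnA leq_add2l.
exact: f_exch (ltnW lt_c) le_at ge_s.
Qed.

Theorem lemma0p3 (m d t s : nat) (a b : nat -> nat)
    (m_gt0 : 0 < m) (d_gt0 : 0 < d) (t_gt0 : 0 < t) (s_gt0 : 0 < s)
    (a_sorted : forall i j, 1 <= i -> i <= j -> j <= t -> a i <= a j)
    (b_first : b 1 <= 'C(m - 1 + d, d))
    (b_rest : forall j, 2 <= j -> j <= s -> b j = 'C(m - 1 + d, d))
    (a_le_b : forall i, 1 <= i -> i <= t -> a i <= b s)
    (sum_le : \sum_(1 <= i < t.+1) a i <= \sum_(1 <= j < s.+1) b j) :
  \sum_(1 <= i < t.+1) macaulay d (a i) <= \sum_(1 <= j < s.+1) macaulay d (b j).
Proof.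
set M := 'C(m - 1 + d, d) in b_first b_rest.
have M_gt0 : 0 < M by rewrite bin_gt0 leq_addl.
have fE l : l <= M -> macaulay d l = psum (growth_word (m - 1) d) l.
  exact: macaulay_psum.
have [f_add f_exch] := balanced_growth_word (m - 1) d.
rewrite size_growth_word -/M in f_add f_exch.
(* When s = 1, b s is b 1, which may be smaller than M. *)
have le_aM i : 1 <= i -> i <= t -> a i <= M.
  move=> i_gt0 le_i; apply: leq_trans (a_le_b i i_gt0 le_i) _.
  by have [|gt1] := leqP s 1; [case: (s) s_gt0 => [|[]] | rewrite b_rest].
have sum_b g : \sum_(1 <= j < s.+1) g (b j) = g (b 1) + s.-1 * g M.
  rewrite big_ltn //; congr (_ + _).
  rewrite (eq_big_nat _ _ (F2 := fun=> g M)) => [|j /andP[j_ge2 j_le]].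
    by rewrite sum_nat_const_nat; congr (_ * _); lia.
  by rewrite b_rest.
rewrite (sum_b id) /= in sum_le; rewrite sum_b.
set A := \sum_(1 <= i < t.+1) a i in sum_le.
have f0 : macaulay d 0 = 0 by exact: macaulay0.
have fD i j : i + j <= M -> macaulay d i + macaulay d j <= macaulay d (i + j).
  by move=> le_ij; rewrite !fE ?f_add; lia.
have fX i j : i <= M -> j <= M -> M <= i + j ->
    macaulay d i + macaulay d j <= macaulay d M + macaulay d (i + j - M).
  by move=> le_i le_j ge_ij; rewrite !fE ?f_exch; lia.
apply: leq_trans (sum_merge_le M_gt0 f0 fD fX le_aM) _; rewrite -/A.
have f_mono i j : i <= j -> j <= M -> macaulay d i <= macaulay d j.
  by move=> le_ij le_j; have := fD i (j - i); rewrite subnKC //; lia.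
have lt_c : A %% M < M by rewrite ltn_mod.
rewrite (divn_eq A M) in sum_le; move: (A %/ M) (A %% M) lt_c sum_le.
move=> q c lt_c sum_le.
have EsM : s * M = M + s.-1 * M by rewrite -mulSn prednK.
have le_q : q <= s by rewrite -(leq_pmul2r M_gt0); lia.
have [Eq|[Eq|lt_q]] : q = s \/ q = s.-1 \/ q < s.-1 by lia.
- (* The largest possible q forces equality throughout. *)
  rewrite Eq in sum_le; have -> : c = 0 by lia.
  have -> : b 1 = M by lia.
  by rewrite f0 addn0 -mulSn Eq prednK.
- rewrite Eq in sum_le *; rewrite addnC leq_add2r; apply: f_mono => //; lia.
(* The remainder c is absorbed by one of the unused copies of M. *)
apply: leq_trans (leq_addl _ _).
apply: (@leq_trans (q.+1 * macaulay d M)); last by rewrite leq_mul2r lt_q orbT.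
by rewrite mulSnr leq_add2l f_mono // ltnW.
Qed.
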